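(* Let $(X,d)$ be a complete multiplicative metric space. Suppose the mapping $f:X\to X$ satisfies $$d(f(x),f(y))\le \bigl(d(f(x),x)\cdot d(f(y),y)\bigr)^{\lambda}\quad\text{for all } x,y\in X,$$ where $\lambda\in[0,\tfrac12)$ is a constant. Then $f$ has a unique fixed point in $X$. Moreover, for any $x\in X$, the sequence of iterates $(f^n(x))$ is multiplicative convergent to the fixed point.
   Context: A multiplicative metric on a nonempty set $X$ is a mapping $d:X\times X\to\mathbb{R}$ such that for all $x,y,z\in X$: (m1) $d(x,y)\ge 1$, and $d(x,y)=1$ if and only if $x=y$; (m2) $d(x,y)=d(y,x)$; (m3) $d(x,z)\le d(x,y)\cdot d(y,z)$. The pair $(X,d)$ is then called a multiplicative metric space. A sequence $(x_n)$ in $X$ is multiplicative convergent to $x\in X$ if for every $\varepsilon>1$ there is $N\in\mathbb{N}$ such that $d(x_n,x)<\varepsilon$ for all $n\ge N$. It is a multiplicative Cauchy sequence if for every $\varepsilon>1$ there is $N\in\mathbb{N}$ such that $d(x_m,x_n)<\varepsilon$ for all $m,n\ge N$. The space $(X,d)$ is complete if every multiplicative Cauchy sequence in $X$ is multiplicative convergent to some $x\in X$. $f^n$ denotes the $n$-fold composition of $f$ with itself. *)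

(* Defs.v *)
From Stdlib Require Import Reals.
Open Scope R_scope.

Record multiplicative_metric {X : Type} (d : X -> X -> R) : Prop := {
  mm_ge1 : forall x y : X, 1 <= d x y;
  mm_eq1 : forall x y : X, d x y = 1 <-> x = y;
  mm_sym : forall x y : X, d x y = d y x;
  mm_tri : forall x y z : X, d x z <= d x y * d y z
}.

Definition mult_converges {X : Type} (d : X -> X -> R) (u : nat -> X) (x : X) : Prop :=
  forall eps : R, 1 < eps ->
    exists N : nat, forall n : nat, (N <= n)%nat -> d (u n) x < eps.

Definition mult_Cauchy {X : Type} (d : X -> X -> R) (u : nat -> X) : Prop :=
  forall eps : R, 1 < eps ->
    exists N : nat, forall m n : nat, (N <= m)%nat -> (N <= n)%nat -> d (u m) (u n) < eps.

Definition mult_complete {X : Type} (d : X -> X -> R) : Prop :=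
  forall u : nat -> X, mult_Cauchy d u -> exists x : X, mult_converges d u x.

(* Main.v *)
Require Import Defs.
From Stdlib Require Import Reals Lra Lia.
Open Scope R_scope.

(** Put [e x y = ln (d x y)].  The logarithm turns the multiplicative axioms into
    those of an ordinary metric, and the hypothesis on [f] into Kannan's condition
    [e (f x) (f y) <= lambda * (e (f x) x + e (f y) y)].

    Along an orbit [x_n], let [a_n = e x_(n+1) x_n].  The condition at
    [x_(n+1), x_n] gives [a_(n+1) <= lambda * (a_(n+1) + a_n)], that is
    [a_(n+1) <= lambda / (1 - lambda) * a_n]; the ratio is below 1 exactly because
    [lambda < 1 / 2], so [a_n] tends to 0 ([kannan_step_vanishes]).  The same
    condition at two orbit points bounds [e x_(m+1) x_(n+1)] by
    [lambda * (a_m + a_n)], so the orbit is Cauchy with no summation of a geometric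
    series ([kannan_orbit_Cauchy]).  For a limit [p] of the orbit,
    [e (f p) p <= e (f p) x_(n+1) + e x_(n+1) p
               <= lambda * (e (f p) p + a_n) + e x_(n+1) p];
    letting [n] grow leaves [(1 - lambda) * e (f p) p <= 0], so [p] is fixed
    ([kannan_limit_fixed]).  Two fixed points are at distance at most
    [lambda * (0 + 0)], so they agree ([kannan_fixed_unique]); hence the limits of
    all orbits coincide. *)

Definition log_dist {X : Type} (d : X -> X -> R) (x y : X) : R := ln (d x y).

(** * The logarithm of a multiplicative metric *)

Lemma ln_le (x y : R) : 0 < x -> x <= y -> ln x <= ln y.
Proof.
intros Hx [Hlt | ->]; [| apply Rle_refl].
now apply Rlt_le, ln_increasing.
Qed.

Section LogDist.

Context {X : Type} {d : X -> X -> R} (d_metric : multiplicative_metric d).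

Lemma mm_pos (x y : X) : 0 < d x y.
Proof. pose proof (mm_ge1 _ d_metric x y); lra. Qed.

Lemma log_dist_nonneg (x y : X) : 0 <= log_dist d x y.
Proof.
unfold log_dist; rewrite <- ln_1.
apply ln_le; [lra | apply (mm_ge1 _ d_metric)].
Qed.

Lemma log_dist_refl (x : X) : log_dist d x x = 0.
Proof.
unfold log_dist; rewrite (proj2 (mm_eq1 _ d_metric x x) eq_refl); apply ln_1.
Qed.

Lemma log_dist_separates (x y : X) : log_dist d x y <= 0 -> x = y.
Proof.
intros Hle; apply (mm_eq1 _ d_metric).
apply ln_inv; [apply mm_pos | lra |].
rewrite ln_1; pose proof (log_dist_nonneg x y); unfold log_dist in *; lra.
Qed.

Lemma log_dist_triangle (x y z : X) :
  log_dist d x z <= log_dist d x y + log_dist d y z.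
Proof.
unfold log_dist; rewrite <- ln_mult by apply mm_pos.
apply ln_le; [apply mm_pos | apply (mm_tri _ d_metric)].
Qed.

Lemma log_dist_lt_exp (x y : X) (r : R) : log_dist d x y < r -> d x y < exp r.
Proof.
intros Hlt; rewrite <- (exp_ln (d x y)) by apply mm_pos.
now apply exp_increasing.
Qed.

Lemma mult_converges_log_dist (u : nat -> X) (x : X) :
  mult_converges d u x ->
  forall eps, 0 < eps ->
    exists N, forall n, (N <= n)%nat -> log_dist d (u n) x < eps.
Proof.
intros Hu eps Heps.
destruct (Hu (exp eps)) as [N HN].
{ rewrite <- exp_0; now apply exp_increasing. }
exists N; intros n Hn; unfold log_dist.
rewrite <- (ln_exp eps); apply ln_increasing; [apply mm_pos | now apply HN].
Qed.

Lemma mult_Cauchy_log_dist (u : nat -> X) :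
  (forall eps, 0 < eps ->
    exists N, forall m n, (N <= m)%nat -> (N <= n)%nat ->
      log_dist d (u m) (u n) < eps) ->
  mult_Cauchy d u.
Proof.
intros Hu eps Heps.
destruct (Hu (ln eps)) as [N HN].
{ rewrite <- ln_1; apply ln_increasing; lra. }
exists N; intros m n Hm Hn.
rewrite <- (exp_ln eps) by lra.
now apply log_dist_lt_exp, HN.
Qed.

End LogDist.

(** * Sequences dominated by a geometric one *)

Lemma ratio_lt1_vanishes (a : nat -> R) (h : R) :
  0 <= h < 1 -> 0 <= a 0%nat -> (forall n, a (S n) <= h * a n) ->
  forall eps, 0 < eps -> exists N, forall n, (N <= n)%nat -> a n < eps.
Proof.
intros Hh Ha0 Hstep eps Heps.
assert (Hgeo : forall n, a n <= h ^ n * a 0%nat).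
{ induction n as [|n IH]; simpl; [lra |].
  apply Rle_trans with (1 := Hstep n).
  rewrite Rmult_assoc; apply Rmult_le_compat_l; [lra | exact IH]. }
(* The denominator is [a 0 + 1] because [a 0] may vanish. *)
destruct (pow_lt_1_zero h) with (y := eps / (a 0%nat + 1)) as [N HN].
{ rewrite Rabs_pos_eq; lra. }
{ apply Rdiv_lt_0_compat; lra. }
exists N; intros n Hn.
specialize (HN n Hn).
rewrite Rabs_pos_eq in HN by (apply pow_le; lra).
apply (Rmult_lt_compat_r (a 0%nat + 1)) in HN; [| lra].
unfold Rdiv in HN; rewrite Rmult_assoc, Rinv_l, Rmult_1_r in HN by lra.
specialize (Hgeo n).
pose proof (pow_le h n (proj1 Hh)); lra.
Qed.

(** * Kannan contractions *)

Section Kannan.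

Context {X : Type} {d : X -> X -> R} {f : X -> X} {lambda : R}.
Context (d_metric : multiplicative_metric d).
Context (lambda_range : 0 <= lambda < 1 / 2).
Context (f_contr :
  forall x y : X, d (f x) (f y) <= Rpower (d (f x) x * d (f y) y) lambda).

Lemma kannan_log_dist (x y : X) :
  log_dist d (f x) (f y) <= lambda * (log_dist d (f x) x + log_dist d (f y) y).
Proof.
unfold log_dist.
rewrite <- ln_mult by apply (mm_pos d_metric).
rewrite <- ln_Rpower.
apply ln_le; [apply (mm_pos d_metric) | apply f_contr].
Qed.

Lemma kannan_step_vanishes (x : X) (eps : R) :
  0 < eps ->
  exists N, forall n, (N <= n)%nat ->
    log_dist d (f (Nat.iter n f x)) (Nat.iter n f x) < eps.
Proof.
apply (ratio_lt1_vanishes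
  (fun n => log_dist d (f (Nat.iter n f x)) (Nat.iter n f x))
  (lambda / (1 - lambda))).
- split.
  + apply Rmult_le_pos; [lra |].
    apply Rlt_le, Rinv_0_lt_compat; lra.
  + apply Rmult_lt_reg_r with (1 - lambda); [lra |].
    unfold Rdiv; rewrite Rmult_assoc, Rinv_l; lra.
- apply (log_dist_nonneg d_metric).
- intros n; simpl.
  pose proof (kannan_log_dist (f (Nat.iter n f x)) (Nat.iter n f x)) as Hk.
  apply Rmult_le_reg_l with (1 - lambda); [lra |].
  unfold Rdiv.
  replace ((1 - lambda) * (lambda * / (1 - lambda) *
      log_dist d (f (Nat.iter n f x)) (Nat.iter n f x)))
    with (lambda * log_dist d (f (Nat.iter n f x)) (Nat.iter n f x))
    by (field; lra).
  lra.
Qed.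

Lemma kannan_orbit_Cauchy (x : X) : mult_Cauchy d (fun n => Nat.iter n f x).
Proof.
apply (mult_Cauchy_log_dist d_metric); intros eps Heps.
destruct (kannan_step_vanishes x eps Heps) as [N HN].
(* Kannan's condition speaks of images under [f], hence the shift of indices. *)
exists (S N); intros [|m] [|n] Hm Hn; try lia; simpl.
apply Rle_lt_trans with (1 := kannan_log_dist _ _).
specialize (HN m) as Hm'; specialize (HN n) as Hn'.
assert (Hsum : lambda *
    (log_dist d (f (Nat.iter m f x)) (Nat.iter m f x) +
     log_dist d (f (Nat.iter n f x)) (Nat.iter n f x)) <= lambda * (eps + eps)).
{ apply Rmult_le_compat_l; [lra |].
  apply Rplus_le_compat; apply Rlt_le; [apply Hm' | apply Hn']; lia. }
assert (lambda * eps < 1 / 2 * eps) by (apply Rmult_lt_compat_r; lra).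
lra.
Qed.

(** Kannan's condition bounds [e (f p) x_(n+1)] and so does the work of continuity
    of [f] at [p]; the term in [e (f p) p] of this bound is absorbed on the left
    since [lambda < 1]. *)
Lemma kannan_limit_fixed (x p : X) :
  mult_converges d (fun n => Nat.iter n f x) p -> f p = p.
Proof.
intros Hlim; apply (log_dist_separates d_metric), Rnot_lt_le; intros Hpos.
(* A quarter suffices: the two error terms add up to at most [(1 + lambda) / 4]
   of [e (f p) p], which is less than [1 - lambda] of it. *)
set (D := log_dist d (f p) p) in *.
destruct (mult_converges_log_dist d_metric _ _ Hlim (D / 4)) as [N1 HN1]; [lra |].
destruct (kannan_step_vanishes x (D / 4)) as [N2 HN2]; [lra |].
set (n := Nat.max N1 N2).
assert (Hclose : log_dist d (f (Nat.iter n f x)) p < D / 4)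
  by (apply (HN1 (S n)); lia).
assert (Hstep := HN2 n ltac:(lia)).
pose proof (kannan_log_dist p (Nat.iter n f x)) as Hk; fold D in Hk.
pose proof (log_dist_triangle d_metric (f p) (f (Nat.iter n f x)) p) as Ht;
  fold D in Ht.
assert (lambda * (D + log_dist d (f (Nat.iter n f x)) (Nat.iter n f x))
        <= 1 / 2 * (D + D / 4)).
{ apply Rmult_le_compat; try lra.
  pose proof (log_dist_nonneg d_metric (f (Nat.iter n f x)) (Nat.iter n f x)); lra. }
lra.
Qed.

Lemma kannan_fixed_unique (p q : X) : f p = p -> f q = q -> p = q.
Proof.
intros Hp Hq; apply (log_dist_separates d_metric).
pose proof (kannan_log_dist p q) as Hk.
rewrite Hp, Hq, !(log_dist_refl d_metric) in Hk; lra.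
Qed.

End Kannan.

Theorem theorem3p5 (X : Type) (d : X -> X -> R) (f : X -> X) (lambda : R)
  (X_nonempty : inhabited X)
  (d_metric : multiplicative_metric d)
  (d_complete : mult_complete d)
  (lambda_range : 0 <= lambda < 1 / 2)
  (f_contr : forall x y : X, d (f x) (f y) <= Rpower (d (f x) x * d (f y) y) lambda) :
  exists p : X,
    unique (fun q : X => f q = q) p /\
    (forall x : X, mult_converges d (fun n : nat => Nat.iter n f x) p).
Proof.
assert (Horbit : forall x, exists p,
  mult_converges d (fun n => Nat.iter n f x) p /\ f p = p).
{ intros x.
  destruct (d_complete _ (kannan_orbit_Cauchy d_metric lambda_range f_contr x))
    as [p Hp].
  exists p; split; [exact Hp |].
  exact (kannan_limit_fixed d_metric lambda_range f_contr x p Hp). }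
pose proof (kannan_fixed_unique d_metric f_contr) as Huniq.
destruct X_nonempty as [x0].
destruct (Horbit x0) as [p [_ Hp]].
exists p; split.
- split; [exact Hp |]; intros q Hq; now apply Huniq.
- intros x; destruct (Horbit x) as [q [Hlim Hq]].
  now rewrite (Huniq p q Hp Hq).
Qed.
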